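(* Let $N\ge2$, $\mathbf{z}=(z_1>\cdots>z_N)$, and $\mathsf{a}=(\mathsf{a}_1,\ldots,\mathsf{a}_N)\in\mathbb{R}^N$. For an array $\mathbf{Y}=(\mathbf{y}^1,\ldots,\mathbf{y}^{N-1})$ let $$\rho(\mathbf{Y})=\min_{1\le k\le N-1}\ \min_{1\le p\le k}\ \min_{1\le q\le k+1}|y_p^k-y_q^{k+1}|,\qquad \mathbf{y}^N=\mathbf{z},$$ denote its smallest cross-level gap. There is a constant $C=C(N,\mathbf{z},\mathsf{a})$ such that $$H_{\mathsf{a}}(\mathbf{Y})\ \ge\ \frac12\log\frac{1}{\rho(\mathbf{Y})}-C$$ at every point $\mathbf{Y}$ of the open Gelfand--Tsetlin polytope with top row $\mathbf{z}$. In particular, $H_{\mathsf{a}}(\mathbf{Y})\to+\infty$ as $\mathbf{Y}$ approaches any boundary point of the polytope, and every sublevel set of $H_{\mathsf{a}}$ is a compact subset of the interior of the polytope.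
   Context: The Gelfand--Tsetlin polytope with top row $\mathbf{z}$ is the set of arrays $\mathbf{Y}=(\mathbf{y}^1,\ldots,\mathbf{y}^{N-1})$, $\mathbf{y}^k=(y_1^k,\ldots,y_k^k)\in\mathbb{R}^k$, such that with $\mathbf{y}^N=\mathbf{z}$ one has $y_1^{k+1}\ge y_1^k\ge y_2^{k+1}\ge\cdots\ge y_k^k\ge y_{k+1}^{k+1}$ for all $k=1,\ldots,N-1$; the open polytope (its interior) is where all these inequalities are strict. The effective Hamiltonian, defined on the open polytope, is $$H_{\mathsf{a}}(\mathbf{Y})=\sum_{k=1}^{N-1}\Bigl[\sum_{1\le i<j\le k}\log(y_i^k-y_j^k)-\frac12\sum_{p=1}^k\sum_{q=1}^{k+1}\log|y_p^k-y_q^{k+1}|-\frac{\mathsf{a}_k-\mathsf{a}_{k+1}}{2}\sum_{i=1}^k y_i^k\Bigr],\qquad \mathbf{y}^N=\mathbf{z}.$$ *)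

(* Defs.v *)
From HB Require Import structures.
From mathcomp Require Import all_boot all_order all_algebra.
From mathcomp Require Import all_classical all_reals all_analysis.

Set Implicit Arguments.
Unset Strict Implicit.
Unset Printing Implicit Defensive.

Import Order.TTheory GRing.Theory Num.Theory.
Import numFieldNormedType.Exports.

Local Open Scope classical_set_scope.
Local Open Scope ring_scope.

(* All indices start at 0: level k : 'I_N.-1 is the row y^{k+1} of R^{k+1},
   and the row of index N.-1 is the top row y^N = z. *)

(* Arrays (y^1, ..., y^{N-1}), topologized as R^1 x ... x R^{N-1}. *)
Definition gt_array (R : realType) (N : nat) :=
  prod_topology (fun k : 'I_N.-1 => 'rV[R]_k.+1).

(* Access by natural numbers; the value 0 is only taken out of range. *)
Definition rv_coord (R : realType) (n : nat) (v : 'rV[R]_n) (i : nat) : R :=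
  if insub i is Some j then v 0 j else 0.

Definition gt_entry (R : realType) (N : nat) (z : 'rV[R]_N) (Y : gt_array R N)
    (k i : nat) : R :=
  if insub k is Some l then rv_coord (Y l) i else rv_coord z i.

Definition gt_polytope (R : realType) (N : nat) (z : 'rV[R]_N) :
    set (gt_array R N) :=
  [set Y | forall (k : 'I_N.-1) (i : 'I_k.+1),
    gt_entry z Y k.+1 i >= gt_entry z Y k i /\
    gt_entry z Y k i >= gt_entry z Y k.+1 i.+1].

Definition gt_open_polytope (R : realType) (N : nat) (z : 'rV[R]_N) :
    set (gt_array R N) :=
  [set Y | forall (k : 'I_N.-1) (i : 'I_k.+1),
    gt_entry z Y k.+1 i > gt_entry z Y k i /\
    gt_entry z Y k i > gt_entry z Y k.+1 i.+1].

(* Meaningful on gt_open_polytope z only. *)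
Definition eff_ham (R : realType) (N : nat) (z a : 'rV[R]_N)
    (Y : gt_array R N) : R :=
  \sum_(k < N.-1)
    (\sum_(i < k.+1) \sum_(j < k.+1 | (i < j)%N)
        ln (gt_entry z Y k i - gt_entry z Y k j)
     - 2^-1 * \sum_(p < k.+1) \sum_(q < k.+2)
        ln `|gt_entry z Y k p - gt_entry z Y k.+1 q|
     - (rv_coord a k - rv_coord a k.+1) / 2 * \sum_(i < k.+1) gt_entry z Y k i).

Definition cross_gap (R : realType) (N : nat) (z : 'rV[R]_N) (Y : gt_array R N)
    (k p q : nat) : R :=
  `|gt_entry z Y k p - gt_entry z Y k.+1 q|.

(* The initial value of the minima is itself one of the gaps when 2 <= N, so
   that this is the minimum of all the cross-level gaps. *)
Definition min_gap (R : realType) (N : nat) (z : 'rV[R]_N) (Y : gt_array R N)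
    : R :=
  \big[Num.min/cross_gap z Y 0 0 0]_(k < N.-1)
    \big[Num.min/cross_gap z Y 0 0 0]_(p < k.+1)
      \big[Num.min/cross_gap z Y 0 0 0]_(q < k.+2) cross_gap z Y k p q.

Definition boundary (T : topologicalType) (A : set T) : set T :=
  closure A `\` interior A.

(* Main.v *)
Require Import Defs.
From mathcomp Require Import all_boot all_order all_algebra lra zify.
From mathcomp Require Import all_classical all_reals all_analysis.
Import Order.TTheory GRing.Theory Num.Theory.
Import numFieldNormedType.Exports.
Local Open Scope classical_set_scope.
Local Open Scope ring_scope.

(** Write V_k for the sum of log (y_i^k - y_j^k) over i < j, and L_k for the sum
    of log |y_p^k - y_q^{k+1}| over all p and q.  Since V_1 = 0, telescoping gives
      2 * sum_{k < N} (V_k - L_k / 2) = sum_{k < N} (V_k + V_{k+1} - L_k) - V_N,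
    and V_N depends on z only, while the linear part of the Hamiltonian is
    bounded on the polytope ([eff_ham_cauchy], [lin_term_le]).  So everything
    rests on a lower bound for V_k + V_{k+1} - L_k, the logarithm of a Cauchy
    determinant in two interlacing rows y = y^k and x = y^{k+1}.

    Merge the rows into one decreasing sequence
      w = (x_0, y_0, x_1, y_1, ..., x_k).
    Then V_k + V_{k+1} - L_k is the sum of (-1)^(j - i) log (w_i - w_j) over
    i < j.  Sort the pairs by their lag j - i, and put the odd lag 2r + 1
    together with the even lag 2r + 2.  There is one more pair of the odd lag
    than of the even one, and each even pair contains the two odd pairs that
    begin or end with it; so if any one odd pair is left out, the remaining odd
    pairs can be matched with larger even pairs ([chain_block_ge]).  The block
    is therefore at least -log of any of its odd gaps.  The odd gaps are exactly
    the cross-level gaps.  Using the prescribed gap g in its own block, and the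
    bound z_1 - z_N on all gaps in the other blocks, one finds that
    V_k + V_{k+1} - L_k is at least log (1 / g) minus a constant
    ([log_cauchy_ge]), and hence that the Hamiltonian is at least
    log (1 / g) / 2 - C for every cross-level gap g ([eff_ham_ge_gap]).

    The rest is topology.  The polytope is closed and the open polytope is
    open, so at a boundary point some cross-level gap vanishes
    ([boundary_gap0]); by continuity it is small nearby, which makes the
    Hamiltonian large.  On a sublevel set all gaps are at least some d > 0, so
    that its closure stays in the open polytope; there the Hamiltonian is
    continuous, hence the sublevel set is closed, and it lies in a compact
    box. *)

(** * Sums over pairs of indices *)

Definition pair_sum {V : nmodType} (n : nat) (F : nat -> nat -> V) : V :=
  \sum_(i < n) \sum_(j < n | (i < j)%N) F i j.

Lemma pair_sumS {V : nmodType} (n : nat) (F : nat -> nat -> V) :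
  pair_sum n.+1 F = pair_sum n F + \sum_(i < n) F i n.
Proof.
rewrite /pair_sum big_ord_recr /= [X in _ + X]big1; last first.
  by move=> j /leq_trans /(_ (leq_ord j)); rewrite ltnn.
rewrite addr0 -big_split; apply: eq_bigr => i _ /=.
by rewrite big_mkcond big_ord_recr -big_mkcond /= ltn_ord.
Qed.

Lemma pair_sum_by_lag {V : nmodType} (n : nat) (F : nat -> nat -> V) :
  pair_sum n F = \sum_(r < n) \sum_(i < n - r.+1) F i (i + r.+1)%N.
Proof.
elim: n => [|n IH]; first by rewrite /pair_sum !big_ord0.
rewrite pair_sumS IH [RHS]big_ord_recr /= subnn big_ord0 addr0.
rewrite [X in _ + X](reindex_inj rev_ord_inj) -big_split; apply: eq_bigr => r _ /=.
by rewrite -[(n.+1 - r.+1)%N]subnSK ?ltnS // subSS big_ord_recr /= subnK.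
Qed.

(** Splits the rectangle p < n, q <= n along its diagonal: the entries with
    q <= p become the pairs (q, p + 1), those with p < q the pairs (p, q). *)
Lemma cross_sum_pairs {V : nmodType} (n : nat) (G : nat -> nat -> V) :
  \sum_(p < n) \sum_(q < n.+1) G p q =
  pair_sum n.+1 (fun i j => G j.-1 i + G i j).
Proof.
elim: n => [|n IH]; first by rewrite /pair_sum big_ord0 big_ord1 big1 // => -[[]].
rewrite pair_sumS -IH big_ord_recr /= big_split /=.
under eq_bigr do rewrite big_ord_recr /=.
rewrite big_split /= -!addrA; congr +%R.
rewrite big_ord_recr /= [X in _ = _ + X]big_ord_recr /=.
by rewrite addrCA.
Qed.

(** * Lower bound for the Cauchy determinant of two interlacing rows *)

(** A and B stand for the logarithms of the gaps of one odd lag, alternating as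
    A_0, B_0, A_1, B_1, ..., A_s, B_s along the merged sequence, and X and Y
    for those of the next even lag: X_i dominates the neighbours A_i, B_i, and Y_i
    the neighbours B_i, A_(i+1).  Leaving out one odd term, those on its left
    are matched with the even term that follows them, and those on its right
    with the even term that precedes them. *)
Lemma chain_block_ge {R : realDomainType} (X A B Y : nat -> R) (s : nat) :
  (forall i, (i <= s)%N -> A i <= X i /\ B i <= X i) ->
  (forall i, (i < s)%N -> B i <= Y i /\ A i.+1 <= Y i) ->
  forall m, (m <= s)%N ->
    let T := \sum_(i < s.+1) (X i - (A i + B i)) + \sum_(i < s) Y i in
    - A m <= T /\ - B m <= T.
Proof.
elim: s => [|s IH] hX hY m.
  rewrite leqn0 => /eqP -> /=; rewrite big_ord1 big_ord0.
  by have := hX 0 (leqnn _); lra.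
have {}IH := IH (fun i hi => hX i (leqW hi)) (fun i hi => hY i (ltnW hi)).
rewrite [in X in X -> _]leq_eqVlt ltnS /= => hm.
rewrite big_ord_recr [X in _ + X]big_ord_recr /=.
have := hX s.+1 (leqnn _); have := hY s (leqnn _).
case/orP: hm => [/eqP ->|/IH /=]; last by lra.
by have /= := IH s (leqnn s); lra.
Qed.

Definition log_vandermonde {R : realType} (n : nat) (y : nat -> R) : R :=
  pair_sum n (fun i j => ln (y i - y j)).

Definition log_cross {R : realType} (n : nat) (x y : nat -> R) : R :=
  \sum_(p < n) \sum_(q < n.+1) ln `|y p - x q|.

(** For interlacing x and y this is the logarithm of the absolute value of the
    Cauchy-type determinant of size n + 1 whose rows are indexed by the x_q and
    whose columns are the n functions 1 / (x_q - y_p) and the constant 1. *)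
Definition log_cauchy {R : realType} (n : nat) (x y : nat -> R) : R :=
  log_vandermonde n.+1 x + log_vandermonde n y - log_cross n x y.

Definition interlacing {R : realType} (n : nat) (x y : nat -> R) : Prop :=
  forall i, (i < n)%N -> y i < x i /\ x i.+1 < y i.

Lemma interlacing_le {R : realType} {n : nat} {x y : nat -> R} {i j : nat} :
  interlacing n x y -> (i <= j)%N -> (j <= n)%N -> x j <= x i.
Proof.
move=> h; elim: j => [|j IH]; first by rewrite leqn0 => /eqP ->.
rewrite leq_eqVlt => /orP[/eqP -> //|]; rewrite ltnS => ij jn.
by have := IH ij (ltnW jn); have := h j jn; lra.
Qed.

Lemma interlacing_ltl {R : realType} {n : nat} {x y : nat -> R} {p q : nat} :
  interlacing n x y -> (q <= p)%N -> (p < n)%N -> y p < x q.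
Proof.
move=> h qp pn.
by have := interlacing_le h qp (ltnW pn); have := h p pn; lra.
Qed.

Lemma interlacing_ltr {R : realType} {n : nat} {x y : nat -> R} {p q : nat} :
  interlacing n x y -> (p < q)%N -> (q <= n)%N -> x q < y p.
Proof.
move=> h pq qn; have pn := leq_trans pq qn.
by have := interlacing_le h pq qn; have := h p pn; lra.
Qed.

(** The block of lag r below gathers the terms of lag 2r + 1 and 2r + 2 of the
    merged sequence x_0, y_0, x_1, ..., x_n.  There are n blocks, each at least
    minus the logarithm of any cross gap that it contains: the block of
    |y_p - x_q| uses that gap, the n - 1 others use M. *)
Lemma log_cauchy_ge {R : realType} {n : nat} {x y : nat -> R} {M : R}
    {p q : nat} :
  interlacing n x y -> x 0%N - x n <= M -> (p < n)%N -> (q <= n)%N ->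
  - ln `|y p - x q| - ln M *+ n.-1 <= log_cauchy n x y.
Proof.
move=> h hM pn qn.
have yx i j := @interlacing_ltl _ _ _ _ i j h.
have xy i j := @interlacing_ltr _ _ _ _ i j h.
pose X r i := ln (x i - x (i + r.+1)%N).
pose Y r i := ln (y i - y (i + r.+1)%N).
pose A r i := ln `|y (i + r)%N - x i|.
pose B r i := ln `|y i - x (i + r.+1)%N|.
pose T r := \sum_(i < n - r) (X r i - (A r i + B r i)) +
            \sum_(i < n - r.+1) Y r i.
have ln_le (u v : R) : 0 < u -> u <= v -> ln u <= ln v.
  by move=> u0 uv; rewrite ler_ln ?posrE // (lt_le_trans u0).
have AE r i : (i + r < n)%N -> A r i = ln (x i - y (i + r)%N).
  move=> h1; have := yx _ _ (leq_addr r i) h1 => h2.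
  by rewrite /A distrC gtr0_norm // subr_gt0.
have BE r i : (i + r < n)%N -> B r i = ln (y i - x (i + r.+1)%N).
  rewrite -addnS => h1; have ii : (i < i + r.+1)%N by rewrite addnS ltnS leq_addr.
  by have := xy _ _ ii h1 => h2; rewrite /B gtr0_norm // subr_gt0.
have TE r m : (m + r < n)%N -> - A r m <= T r /\ - B r m <= T r.
  move=> mr; have rn : (r < n)%N by apply: leq_ltn_trans mr; rewrite leq_addl.
  rewrite /T -(subnSK rn).
  apply: (chain_block_ge (X r) (A r) (B r) (Y r)) => [i hi|i hi|].
  - have ir : (i + r < n)%N by lia.
    have h1 := yx (i + r)%N i ltac:(lia) ir.
    have h2 := xy i (i + r.+1)%N ltac:(lia) ltac:(lia).
    have h3 := h (i + r)%N ir; have h4 := h i ltac:(lia).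
    by rewrite AE // BE // /X addnS; rewrite addnS in h2; split; apply: ln_le; lra.
  - have h1 := yx (i.+1 + r)%N i.+1 ltac:(lia) ltac:(lia).
    have h2 := xy i (i + r.+1)%N ltac:(lia) ltac:(lia).
    have h3 := h (i + r.+1)%N ltac:(lia); have h4 := h i ltac:(lia).
    rewrite AE ?BE; try lia.
    by rewrite addSnnS /Y in h1 *; split; apply: ln_le; lra.
  - by lia.
have -> : log_cauchy n x y = \sum_(r < n) T r.
  rewrite /log_cauchy /log_vandermonde /log_cross.
  rewrite (cross_sum_pairs _ (fun p q => ln `|y p - x q|)).
  rewrite !pair_sum_by_lag !big_ord_recr /= !subnn !big_ord0 !addr0.
  rewrite -big_split -sumrB; apply: eq_bigr => r _ /=.
  rewrite subSS /T sumrB addrAC; congr (_ - _ + _).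
  by apply: eq_bigr => i _; rewrite /A /B addnS.
have Tge r : (r < n)%N -> - ln M <= T r.
  move=> rn; have [+ _] := TE r 0%N rn; apply: le_trans.
  rewrite lerN2 AE //; have h1 := yx r 0%N (leq0n r) rn.
  apply: ln_le; rewrite add0n; first by lra.
  by have := xy r n rn (leqnn _); lra.
(* The gap |y_p - x_q| has odd lag 2 (p - q) + 1 or 2 (q - p) - 1. *)
have [r [rn hr]] : exists r, (r < n)%N /\ - ln `|y p - x q| <= T r.
  have [qp|pq] := leqP q p.
    exists (p - q)%N; split; first by lia.
    by have [] := TE (p - q)%N q ltac:(lia); rewrite /A addnC subnK.
  exists (q - p.+1)%N; split; first by lia.
  by have [_] := TE (q - p.+1)%N p ltac:(lia); rewrite /B subnSK // subnKC // ltnW.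
rewrite (bigD1 (Ordinal rn)) //= lerD // -mulNrn.
rewrite -[n in n.-1]card_ord -(cardC1 (Ordinal rn)) -sumr_const.
by apply: ler_sum => i _; apply: Tge.
Qed.

(** * Entries of the arrays *)

Lemma gt_entry_top {R : realType} {N : nat} (z : 'rV[R]_N) (Y : gt_array R N)
    (i : nat) : gt_entry z Y N.-1 i = rv_coord z i.
Proof. by rewrite /gt_entry insubN // ltnn. Qed.

Lemma rv_coord_ord {R : realType} {n : nat} (v : 'rV[R]_n) (i : 'I_n) :
  rv_coord v i = v 0 i.
Proof. by rewrite /rv_coord valK. Qed.

Lemma gt_polytope_step {R : realType} {N : nat} {z : 'rV[R]_N}
    {Y : gt_array R N} {k i : nat} :
  gt_polytope z Y -> (k < N.-1)%N -> (i <= k)%N ->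
  gt_entry z Y k i <= gt_entry z Y k.+1 i /\
  gt_entry z Y k.+1 i.+1 <= gt_entry z Y k i.
Proof.
move=> h hk hi; have hi' : (i < k.+1)%N by [].
exact: (h (Ordinal hk) (Ordinal hi')).
Qed.

Lemma gt_open_interlacing {R : realType} {N : nat} {z : 'rV[R]_N}
    {Y : gt_array R N} {k : nat} :
  gt_open_polytope z Y -> (k < N.-1)%N ->
  interlacing k.+1 (gt_entry z Y k.+1) (gt_entry z Y k).
Proof. by move=> h hk i hi; apply: (h (Ordinal hk) (Ordinal hi)). Qed.

Lemma gt_open_sub {R : realType} {N : nat} (z : 'rV[R]_N) :
  gt_open_polytope z `<=` gt_polytope z.
Proof. by move=> Y h k i; have [h1 h2] := h k i; split; apply: ltW. Qed.

(** The interlacing moves a bound on a row to the row below it, starting from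
    the top row z. *)
Lemma gt_entry_bounds {R : realType} {N : nat} {z : 'rV[R]_N}
    {Y : gt_array R N} {k i : nat} :
  (forall i j : 'I_N, (i < j)%N -> z 0 i > z 0 j) ->
  gt_polytope z Y -> (k <= N.-1)%N -> (i <= k)%N -> (0 < N)%N ->
  gt_entry z Y k i <= rv_coord z 0 /\ rv_coord z N.-1 <= gt_entry z Y k i.
Proof.
move=> hz hY kN ik N0.
have [d kd] : exists d, (k + d = N.-1)%N by exists (N.-1 - k)%N; rewrite subnKC.
elim: d k i kd kN ik => [|d IH] k i kd kN ik.
  have z_le p q : (p <= q)%N -> (q < N)%N -> rv_coord z q <= rv_coord z p.
    rewrite leq_eqVlt => /orP[/eqP -> //|pq qN].
    rewrite (rv_coord_ord z (Ordinal qN)).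
    by rewrite (rv_coord_ord z (Ordinal (ltn_trans pq qN))) ltW // hz.
  rewrite addn0 in kd; subst k.
  by rewrite gt_entry_top; split; apply: z_le; lia.
have [h1 h2] := gt_polytope_step hY (k := k) (i := i) ltac:(lia) ik.
have [h3 _] := IH k.+1 i ltac:(lia) ltac:(lia) ltac:(lia).
have [_ h4] := IH k.+1 i.+1 ltac:(lia) ltac:(lia) ltac:(lia).
by split; lra.
Qed.

(** * Lower bound for the Hamiltonian *)

Definition lin_term {R : realType} {N : nat} (z a : 'rV[R]_N)
    (Y : gt_array R N) : R :=
  \sum_(k < N.-1)
    (rv_coord a k - rv_coord a k.+1) / 2 * \sum_(i < k.+1) gt_entry z Y k i.

(** Half of each Vandermonde term goes to the row above and half to the row
    below; the leftover at the bottom vanishes because the lowest row has one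
    entry, and the leftover at the top is that of z. *)
Lemma eff_ham_cauchy {R : realType} {N : nat} (z a : 'rV[R]_N)
    (Y : gt_array R N) : (0 < N)%N ->
  eff_ham z a Y =
  2^-1 * (\sum_(k < N.-1)
            log_cauchy k.+1 (gt_entry z Y k.+1) (gt_entry z Y k)
          - log_vandermonde N (rv_coord z))
  - lin_term z a Y.
Proof.
move=> N0; pose v k := log_vandermonde k.+1 (gt_entry z Y k).
have vN : log_vandermonde N (rv_coord z) = v N.-1.
  rewrite /v (prednK N0) /log_vandermonde /pair_sum.
  by apply: eq_bigr => i _; apply: eq_bigr => j _; rewrite !gt_entry_top.
have v0 : v 0%N = 0.
  by rewrite /v /log_vandermonde pair_sumS /pair_sum !big_ord0 addr0.
have tel : \sum_(k < N.-1) (v k.+1 - v k) = v N.-1.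
  by rewrite -(big_mkord xpredT (fun k => v k.+1 - v k)) telescope_sumr // v0 subr0.
rewrite vN -tel -sumrB mulr_sumr -sumrB; apply: eq_bigr => k _.
rewrite /log_cauchy -/(v k) -/(v k.+1) /v /log_vandermonde /pair_sum /log_cross.
by lra.
Qed.

Lemma lin_term_le {R : realType} {N : nat} (z a : 'rV[R]_N) :
  (forall i j : 'I_N, (i < j)%N -> z 0 i > z 0 j) -> (0 < N)%N ->
  exists B : R, forall Y, gt_polytope z Y -> lin_term z a Y <= B.
Proof.
move=> hz N0; pose Z := `|rv_coord z 0| + `|rv_coord z N.-1|.
exists (\sum_(k < N.-1)
  `|(rv_coord a k - rv_coord a k.+1) / 2| * (Z *+ k.+1)) => Y hY.
apply: ler_sum => k _; apply: le_trans (ler_norm _) _; rewrite normrM.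
apply: ler_wpM2l => //; apply: le_trans (ler_norm_sum _ _ _) _.
rewrite -[X in Z *+ X](card_ord k.+1) -sumr_const; apply: ler_sum => i _.
have [h1 h2] := gt_entry_bounds hz hY (ltnW (ltn_ord k)) (leq_ord i) N0.
have := ler_norm (rv_coord z 0); have := ler_norm (- rv_coord z N.-1).
have := normr_ge0 (rv_coord z 0); have := normr_ge0 (rv_coord z N.-1).
rewrite normrN ler_norml /Z => h3 h4 h5 h6.
by apply/andP; split; lra.
Qed.

(** The bound holds for every cross-level gap, not only for the smallest one:
    this is the form that the limit at the boundary and the compactness use. *)
Lemma eff_ham_ge_gap {R : realType} {N : nat} (z a : 'rV[R]_N) :
  (2 <= N)%N -> (forall i j : 'I_N, (i < j)%N -> z 0 i > z 0 j) ->
  exists C : R, forall (Y : gt_array R N) (k p q : nat),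
    gt_open_polytope z Y -> (k < N.-1)%N -> (p <= k)%N -> (q <= k.+1)%N ->
    - (2^-1 * ln (cross_gap z Y k p q)) - C <= eff_ham z a Y.
Proof.
move=> N2 hz; have N0 : (0 < N)%N by exact: ltnW.
have [B hB] := lin_term_le z a hz N0.
pose M := rv_coord z 0 - rv_coord z N.-1; pose l := ln M.
exists (2^-1 * (\sum_(k < N.-1) l *+ k.+1 - l + log_vandermonde N (rv_coord z)) + B).
move=> Y k p q hY kN pk qk; have hP := gt_open_sub z Y hY.
pose E j := log_cauchy j.+1 (gt_entry z Y j.+1) (gt_entry z Y j).
(* The term of level k is bounded below through the given gap; at the other
   levels any gap does, estimated by M as in E_ge0. *)
have E_ge j p' q' : (j < N.-1)%N -> (p' <= j)%N -> (q' <= j.+1)%N ->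
    - ln (cross_gap z Y j p' q') - l *+ j <= E j.
  move=> jN pj qj; apply: (log_cauchy_ge (gt_open_interlacing hY jN)) => //.
  have [h1 _] := gt_entry_bounds hz hP jN (leq0n _) N0.
  have [_ h2] := gt_entry_bounds hz hP jN (leqnn _) N0.
  by rewrite /M; lra.
have E_ge0 (j : 'I_N.-1) : 0 <= E j + l *+ j.+1.
  have := E_ge j 0%N 0%N (ltn_ord j) isT isT.
  have [h1 _] := gt_open_interlacing hY (ltn_ord j) 0%N isT.
  have [h2 _] := gt_entry_bounds hz hP (ltn_ord j) (leq0n _) N0.
  have [_ h3] := gt_entry_bounds hz hP (ltnW (ltn_ord j)) (leq0n _) N0.
  have : ln (cross_gap z Y j 0 0) <= l.
    rewrite /cross_gap distrC gtr0_norm ?subr_gt0 //.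
    by rewrite ler_ln ?posrE /M; lra.
  by rewrite mulrS; lra.
rewrite eff_ham_cauchy //.
have := hB _ hP.
have : - ln (cross_gap z Y k p q) + l <= \sum_(j < N.-1) (E j + l *+ j.+1).
  rewrite (bigD1 (Ordinal kN)) //= mulrS.
  have : 0 <= \sum_(i < N.-1 | i != Ordinal kN) (E i + l *+ i.+1).
    by apply: sumr_ge0 => i _.
  by have := E_ge k p q kN pk qk; lra.
by rewrite big_split /= -/E; lra.
Qed.

(** * Topology of the polytope *)

Lemma gt_entry_continuous {R : realType} {N : nat} (z : 'rV[R]_N) (k i : nat) :
  continuous (fun Y : gt_array R N => gt_entry z Y k i).
Proof.
rewrite /gt_entry; case: insubP => [l _ _|_]; last exact: cst_continuous.
rewrite /rv_coord; case: insubP => [j _ _|_]; last exact: cst_continuous.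
move=> Y.
have hp : {for Y, continuous (fun Y : gt_array R N => Y l)}.
  exact: (@proj_continuous _ (fun k : 'I_N.-1 => 'rV[R]_k.+1) l Y).
exact: (continuous_comp hp (@coord_continuous R 1 l.+1 0 j (Y l))).
Qed.

Lemma gt_gap_continuous {R : realType} {N : nat} (z : 'rV[R]_N)
    (k i k' i' : nat) :
  continuous (fun Y : gt_array R N => gt_entry z Y k i - gt_entry z Y k' i').
Proof.
move=> Y.
exact: (cvgB (gt_entry_continuous z k i Y) (gt_entry_continuous z k' i' Y)).
Qed.

(** The arrays whose consecutive gaps are at least d.  This is closed for every
    d; it is the polytope for d = 0 and contains a given sublevel set for some
    d > 0. *)
Definition gt_margin {R : realType} {N : nat} (z : 'rV[R]_N) (d : R) :
    set (gt_array R N) :=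
  [set Y | forall (k : 'I_N.-1) (i : 'I_k.+1),
    d <= gt_entry z Y k.+1 i - gt_entry z Y k i /\
    d <= gt_entry z Y k i - gt_entry z Y k.+1 i.+1].

Lemma gt_margin0 {R : realType} {N : nat} (z : 'rV[R]_N) :
  gt_margin z 0 = gt_polytope z.
Proof.
by apply/seteqP; split=> Y hY k i; have := hY k i; rewrite !subr_ge0.
Qed.

Lemma gt_margin_open_polytope {R : realType} {N : nat} (z : 'rV[R]_N) (d : R) :
  0 < d -> gt_margin z d `<=` gt_open_polytope z.
Proof. by move=> d0 Y hY k i; have [h1 h2] := hY k i; split; lra. Qed.

Lemma closed_gt_margin {R : realType} {N : nat} (z : 'rV[R]_N) (d : R) :
  closed (gt_margin z d).
Proof.
have cl k i k' i' : closed [set Y | d <= gt_entry z Y k i - gt_entry z Y k' i'].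
  apply: (@closed_comp _ _ (fun Y => gt_entry z Y k i - gt_entry z Y k' i')
                       [set x | d <= x]); last exact: closed_ge.
  by move=> Y _; apply: gt_gap_continuous.
rewrite (_ : gt_margin z d = \bigcap_(k : 'I_N.-1) \bigcap_(i : 'I_k.+1)
    ([set Y | d <= gt_entry z Y k.+1 i - gt_entry z Y k i] `&`
     [set Y | d <= gt_entry z Y k i - gt_entry z Y k.+1 i.+1])).
  by apply: closed_bigI => k _; apply: closed_bigI => i _; apply: closedI.
by apply/seteqP; split=> Y hY k => [_ i _|i]; apply: hY.
Qed.

Lemma open_gt_open_polytope {R : realType} {N : nat} (z : 'rV[R]_N) :
  open (gt_open_polytope z).
Proof.
rewrite openE => Y hY.
have : \forall Y' \near Y, forall (k : 'I_N.-1) (i : 'I_k.+1),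
    gt_entry z Y' k i < gt_entry z Y' k.+1 i /\
    gt_entry z Y' k.+1 i.+1 < gt_entry z Y' k i; last by [].
apply: (filter_forall (nbhs_filter Y)) => k.
apply: (filter_forall (nbhs_filter Y)) => i.
have [h1 h2] := hY k i.
have near_lt k1 i1 k2 i2 : gt_entry z Y k1 i1 < gt_entry z Y k2 i2 ->
    \forall Y' \near Y, gt_entry z Y' k1 i1 < gt_entry z Y' k2 i2.
  rewrite -subr_gt0 => h; have := @gt_gap_continuous _ _ z k2 i2 k1 i1 Y.
  by move=> /cvgr_gt /(_ _ h); apply: filterS => Y' /=; rewrite subr_gt0.
by apply: filterS2 (near_lt _ _ _ _ h1) (near_lt _ _ _ _ h2) => Y'; split.
Qed.

Lemma gt_open_sub_interior {R : realType} {N : nat} (z : 'rV[R]_N) :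
  gt_open_polytope z `<=` interior (gt_polytope z).
Proof.
rewrite -open_subsetE; last exact: open_gt_open_polytope.
exact: gt_open_sub.
Qed.

Lemma gt_polytope_bounded {R : realType} {N : nat} (z : 'rV[R]_N) :
  (forall i j : 'I_N, (i < j)%N -> z 0 i > z 0 j) -> (0 < N)%N ->
  exists2 K : set (gt_array R N), compact K & gt_polytope z `<=` K.
Proof.
move=> hz N0; pose I := `[rv_coord z N.-1, rv_coord z 0]%classic.
pose box (k : 'I_N.-1) := [set v : 'rV[R]_k.+1 | forall i, I (v ord0 i)].
exists [set Y | forall k, box k (Y k)].
  apply: (@tychonoff _ (fun k : 'I_N.-1 => 'rV[R]_k.+1) box) => k.
  apply: (@rV_compact R k.+1 (fun=> I)) => i.
  exact: segment_compact.
move=> Y hY k i /=.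
have [h1 h2] := gt_entry_bounds hz hY (ltnW (ltn_ord k)) (leq_ord i) N0.
move: h1 h2; rewrite /gt_entry valK rv_coord_ord /I /= in_itv /= => -> ->.
by [].
Qed.

(** * Continuity of the Hamiltonian and behaviour at the boundary *)

Lemma cvg_sumr {R : realType} {T : Type} {F : set_system T} {FF : Filter F}
    {J : finType} (P : pred J) (f : J -> T -> R) (l : J -> R) :
  (forall j, P j -> f j x @[x --> F] --> l j) ->
  \sum_(j | P j) f j x @[x --> F] --> \sum_(j | P j) l j.
Proof. by move=> h; apply: cvg_big => //; apply: add_continuous. Qed.

Lemma cvg_ln {R : realType} {T : Type} {F : set_system T} {FF : Filter F}
    (f : T -> R) (l : R) :
  0 < l -> f x @[x --> F] --> l -> ln (f x) @[x --> F] --> ln l.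
Proof. by move=> l0 fl; apply: (cvg_comp _ _ fl); apply: continuous_ln. Qed.

Lemma eff_ham_cvg {R : realType} {N : nat} (z a : 'rV[R]_N)
    (Y : gt_array R N) (F : set_system (gt_array R N)) :
  Filter F -> F --> Y -> gt_open_polytope z Y ->
  eff_ham z a Y' @[Y' --> F] --> eff_ham z a Y.
Proof.
move=> FF FY hY.
have entry k i : gt_entry z Y' k i @[Y' --> F] --> gt_entry z Y k i.
  exact: cvg_comp FY (gt_entry_continuous z k i Y).
have gap k i k' i' : gt_entry z Y' k i - gt_entry z Y' k' i' @[Y' --> F] -->
    gt_entry z Y k i - gt_entry z Y k' i' by apply: cvgB.
apply: cvg_sumr => k _; have hk := gt_open_interlacing hY (ltn_ord k).
apply: cvgB; first apply: cvgB.
- apply: cvg_sumr => i _; apply: cvg_sumr => j ij.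
  apply: cvg_ln (gap _ _ _ _).
  have [h1 _] := hk j (ltn_ord j); rewrite subr_gt0.
  exact: lt_trans h1 (interlacing_ltr hk ij (ltnW (ltn_ord j))).
- apply: cvgMl_tmp; apply: cvg_sumr => p _; apply: cvg_sumr => q _.
  apply: cvg_ln (cvg_norm (gap _ _ _ _)).
  rewrite normr_gt0 subr_eq0; have [qp|pq] := leqP q p.
    by rewrite lt_eqF // (interlacing_ltl hk).
  by rewrite gt_eqF // (interlacing_ltr hk pq) // -ltnS.
- by apply: cvgMl_tmp; apply: cvg_sumr => i _.
Qed.

(** A boundary point lies in the closed polytope but not in the open one, which
    is contained in the interior: one of the defining inequalities is an
    equality. *)
Lemma boundary_gap0 {R : realType} {N : nat} (z : 'rV[R]_N)
    (Y : gt_array R N) : boundary (gt_polytope z) Y ->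
  exists k p q, [/\ (k < N.-1)%N, (p <= k)%N, (q <= k.+1)%N &
                    cross_gap z Y k p q = 0].
Proof.
move=> [clY nintY].
have hP : gt_polytope z Y.
  by move: clY; rewrite -gt_margin0 -(closure_id _).1 //; exact: closed_gt_margin.
apply: contrapT => hno; apply: nintY; apply: gt_open_sub_interior.
have gap_neq0 (k p q : nat) : (k < N.-1)%N -> (p <= k)%N -> (q <= k.+1)%N ->
    gt_entry z Y k p != gt_entry z Y k.+1 q.
  move=> kN pk qk; apply/eqP => e; apply: hno; exists k, p, q; split=> //.
  by rewrite /cross_gap e subrr normr0.
move=> k i; have [h1 h2] := hP k i.
have ik : (i <= k)%N by exact: leq_ord.
split; rewrite lt_neqAle.
  by rewrite h1 gap_neq0 // ltnW.
by rewrite h2 eq_sym gap_neq0.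
Qed.

Theorem lemma5p3 (R : realType) (N : nat) (hN : (2 <= N)%N)
    (z : 'rV[R]_N) (hz : forall i j : 'I_N, (i < j)%N -> z 0 i > z 0 j)
    (a : 'rV[R]_N) :
  [/\ exists C : R, forall Y : gt_array R N, gt_open_polytope z Y ->
        eff_ham z a Y >= 2^-1 * ln (1 / min_gap z Y) - C,
      forall Y0 : gt_array R N, boundary (gt_polytope z) Y0 ->
        eff_ham z a Y @[Y --> within (gt_open_polytope z) (nbhs Y0)] --> +oo
    & forall c : R,
        let S := [set Y | gt_open_polytope z Y /\ eff_ham z a Y <= c] in
        compact S /\ S `<=` interior (gt_polytope z)].
Proof.
have N0 : (0 < N)%N by exact: ltnW.
have N1 : (0 < N.-1)%N by rewrite -subn1 subn_gt0.
have [C hC] := eff_ham_ge_gap z a hN hz.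
have gap_gt0 Y k p q : gt_open_polytope z Y -> (k < N.-1)%N -> (p <= k)%N ->
    (q <= k.+1)%N -> 0 < cross_gap z Y k p q.
  move=> hY kN pk qk; have hk := gt_open_interlacing hY kN.
  rewrite normr_gt0 subr_eq0; have [qp|pq] := leqP q p.
    by rewrite lt_eqF // (interlacing_ltl hk).
  by rewrite gt_eqF // (interlacing_ltr hk pq).
(* The lower bound for the Hamiltonian, solved for the gap. *)
have gap_bound Y k p q A : gt_open_polytope z Y -> (k < N.-1)%N ->
    (p <= k)%N -> (q <= k.+1)%N -> eff_ham z a Y <= A ->
    expR (- 2 * (A + C)) <= cross_gap z Y k p q.
  move=> hY kN pk qk hA; have g0 := gap_gt0 _ _ _ _ hY kN pk qk.
  rewrite -[leRHS]lnK ?posrE // ler_expR.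
  by have := hC _ _ _ _ hY kN pk qk; lra.
split.
- exists C => Y hY; pose good g := 2^-1 * ln (1 / g) - C <= eff_ham z a Y.
  have good_gap k p q : (k < N.-1)%N -> (p <= k)%N -> (q <= k.+1)%N ->
      good (cross_gap z Y k p q).
    move=> kN pk qk; rewrite /good div1r lnV ?posrE ?gap_gt0 //.
    by have := hC _ _ _ _ hY kN pk qk; lra.
  have good_min u v : good u -> good v -> good (Num.min u v).
    by move=> hu hv; case: leP.
  (* A minimum of two numbers is one of them, so the bound passes from all the
     gaps to the smallest one. *)
  rewrite -/(good _) /min_gap.
  apply: (big_ind good) => [||k _]; [exact: good_gap|exact: good_min|].
  apply: (big_ind good) => [||p _]; [exact: good_gap|exact: good_min|].
  apply: (big_ind good) => [||q _]; [exact: good_gap|exact: good_min|].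
  by apply: good_gap => //; rewrite -ltnS.
- move=> Y0 /boundary_gap0 [k [p [q [kN pk qk gap0]]]].
  apply/cvgryPge => A.
  have gapc : cross_gap z Y k p q @[Y --> Y0] --> cross_gap z Y0 k p q.
    exact: (cvg_norm (gt_gap_continuous z k p k.+1 q Y0)).
  have := @cvgr_lt _ _ _ (nbhs_filter Y0) _ _ gapc (expR (- 2 * (A + C))).
  rewrite gap0 expR_gt0 => /(_ isT).
  apply: (@filterS _ _ (nbhs_filter Y0)) => Y /= gapY hY.
  by rewrite leNgt; apply/negP => /ltW /(gap_bound _ _ _ _ _ hY kN pk qk); lra.
- move=> c S; pose d := expR (- 2 * (c + C)).
  have d0 : 0 < d by exact: expR_gt0.
  have Sd : S `<=` gt_margin z d.
    move=> Y [hY hc] k i.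
    have [h1 h2] := gt_open_interlacing hY (ltn_ord k) i (ltn_ord i).
    have g1 := gap_bound Y k i i c hY (ltn_ord k) (leq_ord i) (ltnW (ltn_ord i)) hc.
    have g2 := gap_bound Y k i i.+1 c hY (ltn_ord k) (leq_ord i) (ltn_ord i) hc.
    rewrite /cross_gap distrC gtr0_norm ?subr_gt0 // in g1.
    by rewrite /cross_gap gtr0_norm ?subr_gt0 // in g2.
  have SP : S `<=` gt_polytope z by move=> Y [hY _]; exact: gt_open_sub.
  split; last first.
    by move=> Y [hY _]; exact: gt_open_sub_interior.
  have [K cK PK] := gt_polytope_bounded z hz N0.
  apply: (subclosed_compact _ cK); last exact: subset_trans SP PK.
  move=> Y clY.
  have hY : gt_open_polytope z Y.
    apply: (gt_margin_open_polytope z d d0).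
    rewrite (closure_id (gt_margin z d)).1; last exact: closed_gt_margin.
    exact: closure_subset Sd _ clY.
  split=> //; rewrite leNgt; apply/negP => hlt.
  have Hc := eff_ham_cvg z a Y _ (nbhs_filter Y) cvg_id hY.
  have [Y' [[_ hle] /= hgt]] :=
    clY _ (@cvgr_gt _ _ _ (nbhs_filter Y) _ _ Hc _ hlt).
  by rewrite ltNge hle in hgt.
Qed.
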